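(* Let $n\geq 1$. The set of rank one preorders $\mathrm{ZR}^1(\mathbb Q^n)$, endowed with the Inverse topology, is homeomorphic to the Euclidean sphere $\mathbb S^{n-1}$. Moreover, if $n\geq 2$, the map $\pi:\mathrm{Ord}(\mathbb Q^n)\to\mathrm{ZR}^1(\mathbb Q^n)$, where for $\preceq\in\mathrm{Ord}(\mathbb Q^n)$, $\pi(\preceq)$ is the unique preorder of rank one such that $\pi(\preceq)\,\boldsymbol{\leq}\,\preceq$, is a continuous surjective map (for the Inverse topology) between an ultrametric Cantor set and the $(n-1)$-dimensional sphere.
   Context: $\mathrm{ZR}(\mathbb Q^n)$ is the set of preorders on the additive group $\mathbb Q^n$, i.e. of binary relations $\preceq$ that are total ($u\preceq v$ or $v\preceq u$ for all $u,v$), transitive, and translation-invariant ($u\preceq v$ implies $w+u\preceq w+v$). $\mathrm{Ord}(\mathbb Q^n)$ is the subset of those that are orders (antisymmetric). Write $u\prec v$ if $u\preceq v$ and not $v\preceq u$. The Inverse topology on $\mathrm{ZR}(\mathbb Q^n)$ is the topology generated by the sets $\mathcal U_u=\{\preceq\mid u\succ 0\}$, $u\in\mathbb Q^n$; subsets carry the induced topology. One writes $\preceq_1\,\boldsymbol{\leq}\,\preceq_2$ if $u\preceq_2 v$ implies $u\preceq_1 v$ for all $u,v$. The rank of $\preceq\in\mathrm{ZR}(\mathbb Q^n)$ is $\#\{\preceq'\mid\preceq'\,\boldsymbol{\leq}\,\preceq\}-1$, and $\mathrm{ZR}^1(\mathbb Q^n)$ is the set of preorders of rank one. A Cantor set is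 a non-empty, compact, metrizable, totally disconnected space without isolated points; it is ultrametric when its topology is defined by an ultrametric. *)

(* Defs.v *)
From HB Require Import structures.
From mathcomp Require Import all_boot all_order all_algebra.
From mathcomp Require Import all_classical all_reals all_analysis.

Set Implicit Arguments.
Unset Strict Implicit.
Unset Printing Implicit Defensive.

Import Order.TTheory GRing.Theory Num.Theory.
Import numFieldNormedType.Exports.

Local Open Scope classical_set_scope.
Local Open Scope ring_scope.

Record ZR (n : nat) := MkZR {
  preorder_le :> rel 'rV[rat]_n;
  preorder_total : total preorder_le;
  preorder_trans : transitive preorder_le;
  preorder_translation :
    forall w u v, preorder_le u v -> preorder_le (w + u) (w + v)
}.

Definition preorder_lt (n : nat) (p : ZR n) : rel 'rV[rat]_n :=
  fun u v => p u v && ~~ p v u.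

Definition inverse_subbase (n : nat) (u : 'rV[rat]_n) : set (ZR n) :=
  [set p | preorder_lt p 0 u].

HB.instance Definition _ (n : nat) := gen_eqMixin (ZR n).
HB.instance Definition _ (n : nat) := gen_choiceMixin (ZR n).

(* The Inverse topology: subsets of [ZR n], seen as types, then carry the
   induced topology. *)
HB.instance Definition _ (n : nat) :=
  isSubBaseTopological.Build (ZR n) [set: 'rV[rat]_n] (@inverse_subbase n).

Definition coarser (n : nat) (p1 p2 : ZR n) : Prop :=
  forall u v, p2 u v -> p1 u v.

(* The rank is the cardinality of this set minus one; the set always contains
   [p] itself. *)
Definition has_rank (n : nat) (p : ZR n) (r : nat) : Prop :=
  ([set q | coarser q p] #= `I_r.+1)%card.

Definition ZR1 (n : nat) : set (ZR n) := [set p | has_rank p 1].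
Arguments ZR1 : clear implicits.

Definition Ord (n : nat) : set (ZR n) := [set p | antisymmetric p].
Arguments Ord : clear implicits.

(* The library norm on ['rV[R]_n] is the sup norm. *)
Definition euclidean_norm (R : realType) (n : nat) (x : 'rV[R]_n) : R :=
  Num.sqrt (\sum_(i < n) x 0 i ^+ 2).

(* The sphere of dimension n - 1, inside R^n. *)
Definition sphere (R : realType) (n : nat) : set 'rV[R]_n :=
  [set x | euclidean_norm x = 1].
Arguments sphere : clear implicits.

Definition homeomorphic (X Y : topologicalType) : Prop :=
  exists (f : X -> Y) (g : Y -> X),
    [/\ cancel f g, cancel g f, continuous f & continuous g].

Section metrics.
Variables (R : realType) (T : topologicalType).
Implicit Type d : T -> T -> R.

Definition is_metric d : Prop :=
  [/\ forall x y, 0 <= d x y,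
      forall x y, d x y = 0 <-> x = y,
      forall x y, d x y = d y x &
      forall x y z, d x z <= d x y + d y z].

Definition is_ultrametric d : Prop :=
  is_metric d /\ forall x y z, d x z <= Num.max (d x y) (d y z).

Definition defines_topology d : Prop :=
  forall x : T, nbhs x = filter_from [set e : R | 0 < e]
                           (fun e => [set y | d x y < e]).

Definition metrizable : Prop :=
  exists d, is_metric d /\ defines_topology d.

Definition ultrametrizable : Prop :=
  exists d, is_ultrametric d /\ defines_topology d.

Definition cantor_set : Prop :=
  [/\ [set: T] !=set0, compact [set: T], metrizable,
      totally_disconnected [set: T] & isolated [set: T] = set0].

Definition ultrametric_cantor_set : Prop := cantor_set /\ ultrametrizable.

End metrics.

(* Main.v *)
Require Import Defs.
From HB Require Import structures.
From mathcomp Require Import all_boot all_order all_algebra.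
From mathcomp Require Import all_classical all_reals all_analysis.
From mathcomp Require Import lra.

Set Implicit Arguments.
Unset Strict Implicit.
Unset Printing Implicit Defensive.

Import Order.TTheory GRing.Theory Num.Theory.
Import numFieldNormedType.Exports.

Local Open Scope classical_set_scope.
Local Open Scope ring_scope.

(** A nonzero real vector [l] ranks the rational vectors by the values of the
    linear form [dot l]; this is the preorder [halfspace l], which depends only
    on the ray of [l]. Everything rests on the fact that each nontrivial preorder
    [p] has exactly one unit vector [l], its direction, such that [halfspace l]
    is coarser than [p].

    Existence ([exists_direction]): by Fourier-Motzkin elimination
    ([positive_form]), finitely many vectors that are positive for [p] are made
    positive by a single rational linear form. Compactness of the sphere then
    gives a unit form that is nonnegative on all vectors positive for [p].
    Uniqueness ([direction_unique]): distinct unit vectors are separated by a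
    rational vector on which their forms have opposite strict signs
    ([sphere_separated]).

    Since the reals are archimedean, the only preorders coarser than
    [halfspace l] are itself and the trivial one ([coarser_halfspace]), so the
    rank one preorders are the half-space preorders, and [halfspace] is a
    bijection from the sphere to them, continuous by definition of the Inverse
    topology. Its inverse is the direction map. On any set of nontrivial
    preorders the direction map is continuous, again by separation and
    compactness ([direction_continuous]). Applied to the rank one preorders this
    gives the homeomorphism. Applied to the orders it gives the continuity of
    [pi], which is the direction followed by [halfspace]. The map [pi] is onto
    because ties in a half-space preorder can be broken by any order
    ([lexprod]).

    The orders form a Cantor set. An ultrafilter of orders converges to the order
    that it votes for ([ord_compact]); the condition that a given nonzero vector
    be positive is open and closed; the ultrametric measures how early, in an
    enumeration of the rational vectors, two orders disagree on a sign. Finally a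
    neighbourhood of an order contains all orders refining [halfspace l] for some
    rational [l]; in dimension at least two that form vanishes on some nonzero
    vector, so such orders can disagree with the given one
    ([ord_no_isolated]). *)

(** * The cone of positive vectors of a preorder *)

Section PreorderArithmetic.
Variables (n : nat) (p : ZR n).
Implicit Types u v w : 'rV[rat]_n.

Lemma preorder_refl u : p u u.
Proof. by have := preorder_total p u u; rewrite orbb. Qed.

Lemma preorder_diff u v : p u v = p 0 (v - u).
Proof.
apply/idP/idP => uv.
  by have := preorder_translation (- u) uv; rewrite addNr addrC.
by have := preorder_translation u uv; rewrite addr0 addrC subrK.
Qed.

Lemma preorder_add u v : p 0 u -> p 0 v -> p 0 (u + v).
Proof.
move=> u0 v0; have := preorder_translation u v0; rewrite addr0.
exact: preorder_trans.
Qed.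

Lemma preorder_mulrn u k : p 0 u -> p 0 (u *+ k).
Proof.
move=> u0; elim: k => [|k IH]; first by rewrite mulr0n preorder_refl.
by rewrite mulrS preorder_add.
Qed.

Lemma preorder_ltN0 u : ~~ p u 0 -> preorder_lt p 0 u.
Proof.
move=> u0; rewrite /preorder_lt u0 andbT.
by have := preorder_total p 0 u; rewrite (negPf u0) orbF.
Qed.

Lemma preorder_le0N u : p u 0 = p 0 (- u).
Proof. by rewrite preorder_diff sub0r. Qed.

Lemma preorder_ltW u v : preorder_lt p u v -> p u v.
Proof. by case/andP. Qed.

Lemma preorder_lt_add u v :
  p 0 u -> preorder_lt p 0 v -> preorder_lt p 0 (u + v).
Proof.
move=> u0 /andP[v0 nv0]; rewrite /preorder_lt preorder_add //=.
apply: contra nv0 => uv0; apply: preorder_trans uv0.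
by rewrite preorder_diff addrK.
Qed.

Lemma preorder_lt_mulrn u k : (0 < k)%N -> preorder_lt p 0 (u *+ k) ->
  preorder_lt p 0 u.
Proof.
move=> k0 /andP[_ nu0]; apply: preorder_ltN0; apply: contra nu0.
by rewrite !preorder_le0N -mulNrn; exact: preorder_mulrn.
Qed.

(** With [c] the quotient of the integers [a] and [b], the [b]-th multiple of
    [c *: u] is the [a]-th multiple of [u], hence positive, and only a positive
    vector has a positive integer multiple. *)
Lemma preorder_lt_scale (c : rat) u :
  0 < c -> preorder_lt p 0 u -> preorder_lt p 0 (c *: u).
Proof.
move=> c0 u0.
have d0 : (0 < `|denq c|)%N by rewrite absz_gt0 denq_neq0.
have m0 : (0 < `|numq c|)%N by rewrite absz_gt0 numq_eq0 gt_eqF.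
apply: (preorder_lt_mulrn d0); rewrite -scaler_nat scalerA.
suff -> : `|denq c|%:R * c = `|numq c|%:R :> rat.
  rewrite scaler_nat; case: `|numq c|%N m0 => // m _.
  elim: m => [|m IH]; first by rewrite mulr1n.
  by rewrite mulrS preorder_lt_add // preorder_ltW.
by rewrite !natr_absz !gtr0_norm ?denq_gt0 ?numq_gt0 // numqE mulrC.
Qed.

End PreorderArithmetic.

Lemma ZR_ext n (p q : ZR n) : (forall u, p 0 u = q 0 u) -> p = q.
Proof.
move=> pq; have : p = q :> rel _.
  by apply/funext => u; apply/funext => v; rewrite
[p u v]preorder_diff pq -preorder_diff.
case: p q {pq} => [p p1 p2 p3] [q q1 q2 q3] /= pq.
by subst q; congr MkZR; exact: Prop_irrelevance.
Qed.

Definition trivial_preorder n : ZR n :=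
  @MkZR n (fun _ _ => true) (fun _ _ => isT) (fun _ _ _ _ _ => isT)
    (fun _ _ _ _ => isT).

(** * Refining preorders *)

Section Opposite.
Variables (n : nat) (p : ZR n).

Definition opposite_rel : rel 'rV[rat]_n := fun u v => p v u.

Lemma opposite_total : total opposite_rel.
Proof. by move=> u v; exact: preorder_total. Qed.

Lemma opposite_trans : transitive opposite_rel.
Proof. by move=> v u w vu wv; exact: preorder_trans wv vu. Qed.

Lemma opposite_translation w u v :
  opposite_rel u v -> opposite_rel (w + u) (w + v).
Proof. exact: preorder_translation. Qed.

Definition opposite : ZR n :=
  MkZR opposite_total opposite_trans opposite_translation.

End Opposite.

Section Lexprod.
Variables (n : nat) (p q : ZR n).

Definition lexprod_rel : rel 'rV[rat]_n :=
  fun u v => p u v && (p v u ==> q u v).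

Lemma lexprod_total : total lexprod_rel.
Proof.
move=> u v; rewrite /lexprod_rel.
have := preorder_total p u v; have := preorder_total q u v.
by case: (p u v); case: (p v u); case: (q u v); case: (q v u).
Qed.

Lemma lexprod_trans : transitive lexprod_rel.
Proof.
move=> v u w /andP[uv /implyP quv] /andP[vw /implyP qvw].
rewrite /lexprod_rel (preorder_trans uv vw) /=; apply/implyP => wu.
apply: preorder_trans (quv _) (qvw _); first exact: preorder_trans wu.
exact: preorder_trans uv.
Qed.

Lemma lexprod_translation w u v :
  lexprod_rel u v -> lexprod_rel (w + u) (w + v).
Proof.
move=> /andP[uv /implyP quv]; rewrite /lexprod_rel preorder_translation //=.
apply/implyP => wvu; apply: preorder_translation; apply: quv.
by have := preorder_translation (- w) wvu; rewrite !addKr.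
Qed.

(** The ties of [p] are broken by [q]. Any preorder is completed to an order this
    way, and different tie-breaking orders give different completions. *)
Definition lexprod : ZR n :=
  MkZR lexprod_total lexprod_trans lexprod_translation.

Lemma lexprod_coarser : coarser p lexprod.
Proof. by move=> u v /andP[]. Qed.

Lemma lexprod_lt u v : preorder_lt p u v -> preorder_lt lexprod u v.
Proof.
by rewrite /preorder_lt /= /lexprod_rel => /andP[-> /negPf ->].
Qed.

Lemma lexprod_order : Ord n q -> Ord n lexprod.
Proof.
move=> qO u v /andP[/andP[uv /implyP quv] /andP[vu /implyP qvu]].
by apply: qO; rewrite quv ?qvu.
Qed.

End Lexprod.

(** * Half-space preorders *)

Section LinearForms.
Variables (n : nat) (F : realFieldType).
Implicit Types (l : 'rV[F]_n) (u v : 'rV[rat]_n).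

(** The form may have its coefficients in any real field; rational coefficients
    serve for finite sets of vectors, real ones for whole preorders. *)
Definition dot l u : F := \sum_(i < n) l 0 i * ratr (u 0 i).

Lemma dotD l u v : dot l (u + v) = dot l u + dot l v.
Proof.
by rewrite -big_split; apply: eq_bigr => i _; rewrite mxE rmorphD mulrDr.
Qed.

Lemma dotZ l c u : dot l (c *: u) = ratr c * dot l u.
Proof.
by rewrite mulr_sumr; apply: eq_bigr => i _; rewrite mxE rmorphM mulrCA.
Qed.

Lemma dotN l u : dot l (- u) = - dot l u.
Proof. by rewrite -scaleN1r dotZ rmorphN rmorph1 mulN1r. Qed.

Lemma dot0 l : dot l 0 = 0.
Proof. by rewrite -(scale0r 0) dotZ rmorph0 mul0r. Qed.

Lemma dotMn l u k : dot l (u *+ k) = dot l u *+ k.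
Proof. by rewrite -scaler_nat dotZ ratr_nat mulr_natl. Qed.

Lemma dot_addl l m u : dot (l + m) u = dot l u + dot m u.
Proof. by rewrite -big_split; apply: eq_bigr => i _; rewrite mxE mulrDl. Qed.

Lemma dot_scalel c l u : dot (c *: l) u = c * dot l u.
Proof. by rewrite mulr_sumr; apply: eq_bigr => i _; rewrite mxE mulrA. Qed.

Lemma dot_delta i u : dot (delta_mx 0 i) u = ratr (u 0 i).
Proof.
rewrite /dot (bigD1 i) //= mxE !eqxx mul1r big1 ?addr0 // => j ji.
by rewrite mxE (negPf ji) andbF mul0r.
Qed.

Lemma dot_deltar l i : dot l (delta_mx 0 i) = l 0 i.
Proof.
rewrite /dot (bigD1 i) //= mxE !eqxx rmorph1 mulr1 big1 ?addr0 // => j ji.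
by rewrite mxE (negPf ji) andbF rmorph0 mulr0.
Qed.

Definition halfspace_rel l : rel 'rV[rat]_n := fun u v => dot l u <= dot l v.

Lemma halfspace_total l : total (halfspace_rel l).
Proof. by move=> u v; exact: le_total. Qed.

Lemma halfspace_trans l : transitive (halfspace_rel l).
Proof. by move=> v u w; exact: le_trans. Qed.

Lemma halfspace_translation l w u v :
  halfspace_rel l u v -> halfspace_rel l (w + u) (w + v).
Proof. by rewrite /halfspace_rel !dotD lerD2l. Qed.

Definition halfspace l : ZR n :=
  MkZR (@halfspace_total l) (@halfspace_trans l) (@halfspace_translation l).

Lemma halfspace_lt l u : preorder_lt (halfspace l) 0 u = (0 < dot l u).
Proof.
by rewrite /preorder_lt /= /halfspace_rel dot0 -ltNge andb_idl // => /ltW.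
Qed.

End LinearForms.

Lemma ratr_id (x : rat) : ratr x = x.
Proof. by rewrite -(fmorph_eq_rat idfun). Qed.

(** The lexicographic order: each coordinate breaks the ties of the previous
    ones, and only equal vectors remain tied at the end. *)
Lemma exists_order n : exists p : ZR n, Ord n p.
Proof.
pose lex s := foldr (fun i p => lexprod (halfspace (delta_mx 0 i : 'rV[rat]_n)) p)
  (trivial_preorder n) s.
have lexE s u v : lex s u v -> lex s v u -> {in s, forall i, u 0 i = v 0 i}.
  elim: s => [//|j s IH] /= /andP[uv /implyP quv] /andP[vu /implyP qvu] i.
  rewrite inE => /predU1P[->|]; last exact: IH (quv vu) (qvu uv) i.
  move: uv vu; rewrite /= /halfspace_rel !dot_delta !ratr_id => uv vu.
  by apply/eqP; rewrite eq_le uv.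
exists (lex (enum 'I_n)) => u v /andP[uv vu].
by apply/rowP => i; apply: lexE uv vu _ _; rewrite mem_enum.
Qed.

(** * Positive linear forms on finite sets of positive vectors *)

Lemma exists_between (F : realFieldType) (L U : seq F) :
  {in L & U, forall x y, x < y} ->
  exists t, {in L, forall x, x < t} /\ {in U, forall y, t < y}.
Proof.
elim: L U => [|x L IH] U LU.
  elim: U {LU} => [|y U [t [_ tU]]]; first by exists 0.
  exists (Num.min t (y - 1)); split=> // z; rewrite inE => /predU1P[->|/tU tz].
    by rewrite gt_min gtrDl ltrN10 orbT.
  by rewrite gt_min tz.
have [|t [Lt tU]] := IH U.
  by move=> a b aL bU; apply: LU => //; rewrite inE aL orbT.
have [s [xs sU]] : exists s, x < s /\ {in U, forall y, s < y}.
  have : {in U, forall y, x < y} by move=> y; apply: LU; rewrite mem_head.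
  elim: U {IH LU t Lt tU} => [|y U IH] xU; first by exists (x + 1); rewrite ltrDl.
  have [|s [xs sU]] := IH; first by move=> z zU; apply: xU; rewrite inE zU orbT.
  have xy : x < y by apply: xU; rewrite mem_head.
  exists (Num.min s ((x + y) / 2)); rewrite lt_min xs midf_lt //; split=> // z.
  rewrite inE => /predU1P[->|/sU sz]; rewrite gt_min ?sz // midf_lt ?orbT //.
exists (Num.max s t); split=> z.
  rewrite inE => /predU1P[->|/Lt zt]; first by rewrite lt_max xs.
  by rewrite lt_max zt orbT.
by move=> zU; rewrite gt_max sU // tU.
Qed.

(** Fourier-Motzkin elimination: the last active coordinate [m] is removed by
    replacing the vectors in which it occurs by those positive combinations of a
    vector where it is positive and one where it is negative that cancel it.
    Once every coordinate is gone, the vectors vanish and cannot be positive. *)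
Lemma positive_form_active n (p : ZR n) m (s : seq 'rV[rat]_n) :
  {in s, forall u, preorder_lt p 0 u} ->
  {in s, forall (u : 'rV[rat]_n) (i : 'I_n), (m <= i)%N -> u 0 i = 0} ->
  exists l : 'rV[rat]_n, {in s, forall u, 0 < dot l u}.
Proof.
elim: m s => [|m IH] s ps s0.
  exists 0 => u us; have := ps _ us; have -> : u = 0.
    by apply/rowP => i; rewrite mxE; exact: s0.
  by rewrite /preorder_lt preorder_refl.
have [nm|mn] := leqP n m.
  by apply: IH => // u us i mi; have := ltn_ord i; rewrite ltnNge (leq_trans nm).
pose k := Ordinal mn.
(* [comb u v] cancels the coordinate [k]; its coefficients are positive when
   [u] comes from [sp] and [v] from [sn]. *)
pose comb (u v : 'rV[rat]_n) := (- v 0 k) *: u + u 0 k *: v.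
pose sp := [seq u : 'rV[rat]_n <- s | 0 < u 0 k].
pose sn := [seq u : 'rV[rat]_n <- s | u 0 k < 0].
pose s' := [seq u : 'rV[rat]_n <- s | u 0 k == 0] ++
  [seq comb u v | u <- sp, v <- sn].
have [||l ls'] := IH s'.
- move=> u; rewrite mem_cat => /orP[|/allpairsP[[a b] /= [+ + ->]]].
    by rewrite mem_filter => /andP[_ /ps].
  rewrite !mem_filter => /andP[a0 /ps pa] /andP[b0 /ps pb].
  by apply: preorder_lt_add; rewrite ?preorder_ltW // preorder_lt_scale ?oppr_gt0.
- move=> u us' i mi; have [ik|ik] := eqVneq i k.
    rewrite ik; move: us'; rewrite mem_cat mem_filter => /orP[/andP[/eqP//]|].
    by move=> /allpairsP[[a b] /= [_ _ ->]]; rewrite !mxE mulNr mulrC addNr.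
  have {ik}mi' : (m < i)%N by rewrite ltn_neqAle mi andbT eq_sym.
  move: us'; rewrite mem_cat => /orP[|/allpairsP[[a b] /= [+ + ->]]].
    by rewrite mem_filter => /andP[_ us]; exact: s0.
  rewrite !mem_filter => /andP[_ ua] /andP[_ ub].
  by rewrite !mxE (s0 a ua i mi') (s0 b ub i mi') !mulr0 addr0.
(* Adding [t] to the coordinate [k] of [l] makes it positive on [u] exactly when
   [t] is above [bound u], for [u] in [sp], or below it, for [u] in [sn]. *)
pose bound (u : 'rV[rat]_n) := - dot l u / u 0 k.
have [t [tp tn]] : exists t, {in [seq bound u | u <- sp], forall x, x < t} /\
                             {in [seq bound u | u <- sn], forall y, t < y}.
  apply: exists_between => _ _ /mapP[a asp ->] /mapP[b bsn ->].
  have : 0 < dot l (comb a b).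
    by apply: ls'; rewrite mem_cat; apply/orP; right; apply: allpairs_f.
  move: asp bsn; rewrite !mem_filter => /andP[a0 _] /andP[b0 _].
  rewrite dotD !dotZ !ratr_id /bound => ab.
  by rewrite ltr_pdivrMr // mulrAC ltr_ndivlMr //; lra.
exists (l + t *: delta_mx 0 k) => u us.
rewrite dot_addl dot_scalel dot_delta ratr_id.
have [u0|u0|u0] := ltgtP (u 0 k) 0.
- have /tn : bound u \in [seq bound u | u <- sn].
    by apply: map_f; rewrite mem_filter u0.
  by rewrite /bound ltr_ndivlMr // => ?; lra.
- have /tp : bound u \in [seq bound u | u <- sp].
    by apply: map_f; rewrite mem_filter u0.
  by rewrite /bound ltr_pdivrMr // => ?; lra.
- by rewrite u0 mulr0 addr0 ls' // mem_cat mem_filter u0 eqxx us.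
Qed.

Lemma positive_form n (p : ZR n) (s : seq 'rV[rat]_n) :
  {in s, forall u, preorder_lt p 0 u} ->
  exists l : 'rV[rat]_n, {in s, forall u, 0 < dot l u}.
Proof.
move=> ps; apply: (@positive_form_active n p n) => // u _ i.
by rewrite leqNgt ltn_ord.
Qed.

(** * Rank one preorders *)

Lemma nontrivial_lt n (p : ZR n) :
  p <> trivial_preorder n -> exists u, preorder_lt p 0 u.
Proof.
move=> pt; apply: contrapT => nu; apply: pt; apply: ZR_ext => u /=.
apply: contrapT => /negP pu; apply: nu; exists (- u).
by apply: preorder_ltN0; rewrite preorder_le0N opprK.
Qed.

Lemma rank_oneP n (p : ZR n) :
  ZR1 n p <->
  p <> trivial_preorder n /\
  forall q, coarser q p -> q = p \/ q = trivial_preorder n.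
Proof.
have pp : coarser p p by [].
have tp : coarser (trivial_preorder n) p by [].
split=> [/eq_cardSP[x xp /eq_cardSP[y [yp /= yx]]]|[pt ptP]].
  rewrite II0 card_eq0 => /eqP xy0.
  have xyP q : coarser q p -> q = x \/ q = y.
    move=> qp; apply: contrapT => /not_orP[qx qy].
    by suff : (set0 : set (ZR n)) q by []; rewrite -xy0.
  have pt : p <> trivial_preorder n.
    move=> pt; have ext q : coarser q p -> q = trivial_preorder n.
      by rewrite pt => qt; apply: ZR_ext => u; rewrite qt.
    by apply: yx; rewrite (ext _ yp) (ext _ xp).
  split=> // q /xyP qxy; case: (xyP _ pp) => px; case: (xyP _ tp) => tx.
  - by case: pt; rewrite px tx.
  - by case: qxy => ->; [left|right].
  - by case: qxy => ->; [right|left].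
  - by case: pt; rewrite px tx.
apply/eq_cardSP; exists p => //.
suff -> : [set q | coarser q p] `\ p = [set trivial_preorder n].
  exact: card_set1.
rewrite eqEsubset; split=> [q [/= /ptP[]]//|q ->]; split=> //.
exact/nesym.
Qed.

Section Directions.
Variables (R : realType) (n : nat).
Implicit Types (l m : 'rV[R]_n) (u : 'rV[rat]_n).

Lemma exists_mulrn_lt (a b : R) : b < 0 -> exists k, b *+ k < a.
Proof.
move=> b0; exists (Num.bound (`|a| / - b)).
have : 0 <= `|a| / - b by rewrite divr_ge0 // oppr_ge0 ltW.
move=> /archi_boundP; rewrite ltr_pdivrMr ?oppr_gt0 // mulrN mulr_natl.
by have := ler_norm (- a); rewrite normrN; lra.
Qed.

Lemma halfspace_nontrivial l :
  l != 0 -> halfspace l <> trivial_preorder n.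
Proof.
move=> l0 lt; have /eqP[] := l0; apply/rowP => i; rewrite mxE.
have dot_le u : 0 <= dot l u.
  by have : halfspace l 0 u by [rewrite lt]; rewrite /= /halfspace_rel dot0.
apply/eqP; rewrite eq_le; apply/andP; split.
  have := dot_le (- delta_mx 0 i); rewrite dotN oppr_ge0.
  by rewrite dot_deltar.
by have := dot_le (delta_mx 0 i); rewrite dot_deltar.
Qed.

(** The real numbers being archimedean, a coarsening of [halfspace l] that
    ties with [0] one vector outside the kernel of [l] ties every vector with
    [0], since multiples of the former bound the latter on both sides. *)
Lemma coarser_halfspace l (q : ZR n) : coarser q (halfspace l) ->
  q = halfspace l \/ q = trivial_preorder n.
Proof.
move=> ql; have [[w lw qw]|nw] := pselect (exists2 w, dot l w < 0 & q 0 w).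
  right; apply: ZR_ext => x /=.
  have [k] := exists_mulrn_lt (dot l x) lw; rewrite -dotMn => /ltW xk.
  exact: preorder_trans (preorder_mulrn k qw) (ql _ _ xk).
left; apply: ZR_ext => u; rewrite /= /halfspace_rel dot0.
apply/idP/idP => [qu|lu]; last by apply: ql; rewrite /= /halfspace_rel dot0.
by rewrite leNgt; apply/negP => lu; apply: nw; exists u.
Qed.

Lemma halfspace_rank_one l : l != 0 -> ZR1 n (halfspace l).
Proof.
by move=> l0; apply/rank_oneP; split; [exact: halfspace_nontrivial|
  exact: coarser_halfspace].
Qed.

(** * The direction of a preorder *)

Lemma sphereE l : sphere R n l <-> \sum_(i < n) l 0 i ^+ 2 = 1.
Proof.
rewrite /sphere /= /euclidean_norm; split=> [|->]; last exact: sqrtr1.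
move=> /(congr1 (fun x => x ^+ 2)); rewrite expr1n sqr_sqrtr //.
by apply: sumr_ge0 => i _; exact: sqr_ge0.
Qed.

Lemma sphere_neq0 l : sphere R n l -> l != 0.
Proof.
move=> /sphereE l1; apply/eqP => l0; have /eqP := l1.
by rewrite l0 big1 ?(eq_sym 0) ?oner_eq0 // => i _; rewrite mxE expr0n.
Qed.

Lemma euclidean_norm_gt0 l : l != 0 -> 0 < euclidean_norm l.
Proof.
move=> l0; rewrite sqrtr_gt0 lt_neqAle sumr_ge0 ?andbT; last first.
  by move=> i _; exact: sqr_ge0.
apply: contra l0 => /eqP/esym/psumr_eq0P l0; apply/eqP/rowP => i; rewrite mxE.
by apply/eqP; rewrite -sqrf_eq0 l0 // => j _; exact: sqr_ge0.
Qed.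

Lemma normalize_sphere l :
  l != 0 -> sphere R n ((euclidean_norm l)^-1 *: l).
Proof.
move=> l0; apply/sphereE; under eq_bigr do rewrite mxE exprMn.
have := euclidean_norm_gt0 l0; rewrite -mulr_sumr exprVn sqr_sqrtr; last first.
  by apply: sumr_ge0 => i _; exact: sqr_ge0.
by rewrite sqrtr_gt0 => /gt_eqF l1; rewrite mulVf // l1.
Qed.

Lemma rat_approx l (e : R) : 0 < e ->
  exists u, forall i, `|ratr (u 0 i) - l 0 i| < e.
Proof.
move=> e0; have /choice[f fP] i : exists x : rat, `|ratr x - l 0 i| < e.
  have /rat_in_itvoo[x] : l 0 i - e < l 0 i + e by lra.
  by rewrite in_itv /= => xl; exists x; rewrite ltr_distl.
by exists (\row_i f i) => i; rewrite mxE.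
Qed.

(** The difference [l - m] is positive on the side of [l] and negative on the
    side of [m], by the equality case of Cauchy-Schwarz on the sphere; any
    sufficiently close rational vector does the same. *)
Lemma sphere_separated l m : sphere R n l -> sphere R n m -> l <> m ->
  exists u, 0 < dot l u /\ dot m u < 0.
Proof.
move=> /sphereE l1 /sphereE m1 lm.
pose c := \sum_(i < n) l 0 i * m 0 i.
have c1 : c < 1.
  have : 0 < \sum_(i < n) (l 0 i - m 0 i) ^+ 2.
    have := @euclidean_norm_gt0 (l - m); rewrite sqrtr_gt0 subr_eq0.
    by move=> /(_ (introN eqP lm)); under eq_bigr do rewrite !mxE.
  under eq_bigr do rewrite sqrrB.
  by rewrite big_split sumrB /= l1 m1 sumrMnl -/c; lra.
pose S := \sum_(i < n) (`|l 0 i| + `|m 0 i|) + 1.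
have S0 : 0 < S by rewrite ltr_wpDl // sumr_ge0 // => i _; rewrite addr_ge0.
pose e := (1 - c) / S.
have e0 : 0 < e by rewrite divr_gt0 // subr_gt0.
have [u ue] := rat_approx (l - m) e0.
have close (k : 'rV[R]_n) : (forall i, `|k 0 i| <= `|l 0 i| + `|m 0 i|) ->
    `|dot k u - \sum_(i < n) k 0 i * (l 0 i - m 0 i)| < 1 - c.
  move=> kS; rewrite -sumrB; apply: le_lt_trans (ler_norm_sum _ _ _) _.
  apply: (@le_lt_trans _ _ ((S - 1) * e)); last first.
    by rewrite mulrBl mulrC divfK ?gt_eqF // mul1r gtrBl.
  rewrite /S addrK mulr_suml; apply: ler_sum => i _; rewrite -mulrBr normrM.
  by apply: ler_pM => //; have := ue i; rewrite !mxE => /ltW.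
exists u; split.
  have /close : forall i, `|l 0 i| <= `|l 0 i| + `|m 0 i|.
    by move=> i; rewrite lerDl.
  have -> : \sum_(i < n) l 0 i * (l 0 i - m 0 i) = 1 - c.
    by rewrite -l1 -sumrB; apply: eq_bigr => i _; rewrite mulrBr expr2.
  by rewrite ltr_distl => /andP[]; lra.
have /close : forall i, `|m 0 i| <= `|l 0 i| + `|m 0 i|.
  by move=> i; rewrite lerDr.
have -> : \sum_(i < n) m 0 i * (l 0 i - m 0 i) = c - 1.
  rewrite -m1 -sumrB; apply: eq_bigr => i _.
  by rewrite mulrBr expr2 [l _ _ * _]mulrC.
by rewrite ltr_distl => /andP[]; lra.
Qed.

Lemma direction_unique (p : ZR n) l m : sphere R n l -> sphere R n m ->
  coarser (halfspace l) p -> coarser (halfspace m) p -> l = m.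
Proof.
move=> l1 m1 lp mp; apply: contrapT => /(sphere_separated l1 m1)[u [lu mu]].
have /orP[/mp|/lp] := preorder_total p 0 u; rewrite /= /halfspace_rel dot0.
  by rewrite leNgt mu.
by rewrite leNgt lu.
Qed.

Lemma dot_continuous u : continuous (fun l => dot l u).
Proof.
apply: continuous_big => [|i _ x]; first exact: add_continuous.
have xi := @coord_continuous R 1 n 0 i x; exact: cvgM xi (cvg_cst _).
Qed.

Lemma sphere_compact : compact (sphere R n).
Proof.
have cube : compact [set l : 'rV[R]_n | forall i, `[(-1 : R), 1]%classic (l ord0 i)].
  by apply: (@rV_compact _ _ (fun=> `[(-1 : R), 1]%classic)) => i;
    exact: segment_compact.
apply: subclosed_compact cube _.
  rewrite (_ : sphere R n =
    (fun l => \sum_(i < n) l 0 i ^+ 2) @^-1` [set x | x = 1]).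
    apply: preimage_closed => [l _|]; last exact: closed_eq.
    move: l; apply: continuous_big => [|i _ l]; first exact: add_continuous.
    by have li := @coord_continuous R 1 n 0 i l; exact: (cvgM li li).
  by apply/seteqP; split=> l /sphereE.
move=> l /sphereE l1 i; rewrite /= in_itv /= -ler_norml -(@expr_le1 _ 2) //.
rewrite real_normK ?num_real // -l1 (bigD1 i) //= lerDl.
by apply: sumr_ge0 => j _; exact: sqr_ge0.
Qed.

Lemma dot_ratr (l : 'rV[rat]_n) u :
  dot (map_mx ratr l : 'rV[R]_n) u = ratr (dot l u).
Proof.
rewrite /dot rmorph_sum; apply: eq_bigr => i _.
by rewrite mxE rmorphM ratr_id.
Qed.

(** Every finite set of positive vectors is positive for some form, and the unit
    forms make up a compact set; so one unit form is nonnegative on all positive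
    vectors at once. *)
Lemma exists_direction (p : ZR n) : p <> trivial_preorder n ->
  exists2 l, sphere R n l & coarser (halfspace l) p.
Proof.
move=> /nontrivial_lt[u0 pu0].
pose nonneg u := sphere R n `&` [set l | 0 <= dot l u].
have := sphere_compact; rewrite compact_In0.
move=> /(_ _ [set u | preorder_lt p 0 u] nonneg)[].
- exists (fun u => [set l | 0 <= dot l u]) => // u _.
  apply: (@preimage_closed _ _ (fun l => dot l u)) (@closed_ge _ 0) => l _.
  exact: dot_continuous.
- move=> D Dp; have [|l lD] := @positive_form n p (u0 :: finmap.enum_fset D).
    by move=> u; rewrite inE => /predU1P[->//|/Dp]; rewrite inE.
  pose r : 'rV[R]_n := map_mx ratr l.
  have rD u : u \in u0 :: finmap.enum_fset D -> 0 < dot r u.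
    by rewrite dot_ratr ltr0q => /lD.
  have r0 : r != 0.
    apply/eqP => r0; have := rD u0 (mem_head _ _).
    by rewrite r0 /dot big1 ?ltxx // => i _; rewrite mxE mul0r.
  exists ((euclidean_norm r)^-1 *: r) => u /= uD.
  split; first exact: normalize_sphere.
  rewrite /= dot_scalel mulr_ge0 ?invr_ge0 ?ltW ?euclidean_norm_gt0 //.
  by apply: rD; rewrite inE uD orbT.
move=> l lp; exists l; first by have [] := lp u0 pu0.
move=> u v; rewrite preorder_diff /= /halfspace_rel -subr_ge0 -dotN -dotD.
move: (v - u) => w pw; rewrite leNgt; apply/negP => lw.
(* [w] could be tied with [0], but no multiple of it outweighs [u0]. *)
have [k lwk] := exists_mulrn_lt (- dot l u0) lw.
have [|_ /=] := lp (w *+ k + u0).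
  by apply: preorder_lt_add => //; exact: preorder_mulrn.
by rewrite dotD dotMn; lra.
Qed.

End Directions.

(** * The Inverse topology *)

Lemma filter_in_seq (T : Type) (I : eqType) (F : set_system T) (P : I -> set T)
    (s : seq I) : Filter F ->
  {in s, forall i, F (P i)} -> F [set x | {in s, forall i, P i x}].
Proof.
move=> FF; elim: s => [_|i s IH Fs]; first by apply: filterS filterT.
have Fs' : F [set x | {in s, forall i, P i x}].
  by apply: IH => j js; apply: Fs; rewrite inE js orbT.
apply: filterS2 (Fs i (mem_head _ _)) Fs' => x ix sx j.
by rewrite inE => /predU1P[->|/sx].
Qed.

Section InverseTopology.
Variables (n : nat) (A : set (ZR n)).
Implicit Types (p q : A) (V : set A) (u : 'rV[rat]_n).

Lemma inverse_subbase_open u : open (@inverse_subbase n u).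
Proof.
exists [set @inverse_subbase n u]; last by rewrite bigcup_set1.
by move=> _ ->; exact: finI_from1.
Qed.

Lemma inverse_nbhs_lt p u : preorder_lt (set_val p) 0 u ->
  nbhs p [set q | preorder_lt (set_val q) 0 u].
Proof.
move=> pu; exists [set q | preorder_lt (set_val q) 0 u]; split=> //.
by exists (@inverse_subbase n u) => //; exact: inverse_subbase_open.
Qed.

Lemma inverse_nbhsP p V :
  nbhs p V <->
  exists2 s : seq 'rV[rat]_n, {in s, forall u, preorder_lt (set_val p) 0 u} &
    forall q, {in s, forall u, preorder_lt (set_val q) 0 u} -> V q.
Proof.
split=> [[_ [[C [G GI <-] <-] [B GB Bp] CV]]|[s ps sV]].
  have [D _ DB] := GI _ GB; exists (finmap.enum_fset D) => [u uD|q qD].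
    by rewrite -DB in Bp; exact: (Bp u).
  have Bq : B (set_val q) by rewrite -DB => u; exact: qD.
  by apply: CV; exists B.
apply: filterS sV _; apply: filter_in_seq => u us.
by apply: inverse_nbhs_lt; exact: ps.
Qed.

Lemma inverse_cvg (F : set_system A) (p : A) : Filter F ->
  (forall u, preorder_lt (set_val p) 0 u ->
    F [set q | preorder_lt (set_val q) 0 u]) -> F --> p.
Proof.
move=> FF Fp V /inverse_nbhsP[s ps sV]; apply: filterS sV _.
by apply: filter_in_seq => u us; apply: Fp; exact: ps.
Qed.

End InverseTopology.

(** * Continuity of the direction *)

Lemma set_type_compact (T : topologicalType) (A : set T) :
  compact A -> compact [set: A].
Proof.
move=> cA F FF _.
have [|x [Ax xF]] := cA (set_val @ F) (fmap_proper_filter _ FF).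
  by apply: (@filterS _ F _ setT) filterT => x _; exact: set_valP.
exists (SigSub (mem_set Ax)); split=> // C B FC [_ [[U oU <-] Ux UB]].
have FB : (set_val @ F) (set_val @` C).
  by apply: (@filterS _ F _ C) FC => y Cy; exists y.
have [_ [[y Cy <-] Uy]] := xF _ _ FB (open_nbhs_nbhs (conj oU Ux)).
by exists y; split=> //; exact: UB.
Qed.

Lemma set_type_hausdorff (T : topologicalType) (A : set T) :
  hausdorff_space T -> hausdorff_space A.
Proof.
move=> hT x y xy; apply: val_inj; apply: hT => B C xB yC.
have [z [Bz Cz]] := xy _ _ (initial_continuous xB) (initial_continuous yC).
by exists (set_val z).
Qed.

Lemma dot_sphere_continuous (R : realType) n (u : 'rV[rat]_n) :
  continuous (fun l : sphere R n => dot (set_val l) u).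
Proof.
move=> l; apply: (@continuous_comp _ _ _ set_val (fun l => dot l u)).
  exact: initial_continuous.
exact: dot_continuous.
Qed.

Section DirectionContinuity.
Variables (R : realType) (n : nat) (A : set (ZR n)).

(** If the directions of preorders close to [p] accumulated at a unit vector [m]
    other than that of [p], take a rational [u] on which the direction of [p] is
    positive and [m] is negative. Then [u] is positive for [p], hence for the
    preorders close to [p], so their directions are nonnegative on [u] and stay
    away from [m]. On the compact sphere, a unique accumulation point is a
    limit. *)
Lemma direction_continuous (f : A -> sphere R n) :
  (forall p, coarser (halfspace (set_val (f p))) (set_val p)) -> continuous f.
Proof.
move=> fP p.
have compact_sphere := set_type_compact (@sphere_compact R n).
have clusterP m : cluster (f @ p) m -> m = f p.
  move=> pm; apply: contrapT => mp.
  have [u [pu mu]] : exists u, 0 < dot (set_val (f p)) u /\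
      dot (set_val m) u < 0.
    apply: sphere_separated; try exact: set_valP.
    by move=> /val_inj pm'; exact: mp.
  have pu' : preorder_lt (set_val p) 0 u.
    apply: preorder_ltN0; apply/negP => /fP.
    by rewrite /= /halfspace_rel dot0 leNgt pu.
  have fp : (f @ p) [set l | 0 <= dot (set_val l) u].
    apply: filterS (inverse_nbhs_lt pu') => q /preorder_ltW/fP.
    by rewrite /= /halfspace_rel dot0.
  have nm : nbhs m [set l | dot (set_val l) u < 0].
    have open_neg : open [set x : R | x < 0] by exact: open_lt.
    exact: dot_sphere_continuous (open_nbhs_nbhs (conj open_neg mu)).
  have [l [/= l0]] := pm _ _ fp nm.
  by rewrite ltNge l0.
have fp_proper : ProperFilter (f @ p).
  exact: (@fmap_proper_filter _ _ f (nbhs p) (nbhs_pfilter p)).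
have hausdorff_sphere : hausdorff_space (sphere R n).
  exact: set_type_hausdorff (@norm_hausdorff _ _).
apply: (compact_cluster_set1 hausdorff_sphere compact_sphere filterT
  fp_proper filterT).
apply/seteqP; split=> [m /clusterP//|_ ->].
have [m [_ mc]] := compact_sphere _ fp_proper filterT.
by rewrite -(clusterP _ mc).
Qed.

End DirectionContinuity.

Section HalfspaceContinuity.
Variables (R : realType) (n : nat).

Definition halfspace_ZR1 (l : sphere R n) : ZR1 n :=
  SigSub (mem_set (halfspace_rank_one (sphere_neq0 (set_valP l)))).

Lemma halfspace_continuous : continuous halfspace_ZR1.
Proof.
move=> l; have fl := fmap_filter halfspace_ZR1 (nbhs_filter l).
apply: (inverse_cvg fl) => u; rewrite /= halfspace_lt => lu.
have pos : nbhs l [set m : sphere R n | 0 < dot (set_val m) u].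
  have open_pos : open [set x : R | x > 0] by exact: open_gt.
  exact: dot_sphere_continuous (open_nbhs_nbhs (conj open_pos lu)).
by apply: (@filterS _ (nbhs l) _ _ _ _ pos) => m; rewrite /= halfspace_lt.
Qed.

End HalfspaceContinuity.

(** * The space of orders *)

Section Orders.
Variable n : nat.
Implicit Types (p q r : Ord n) (u : 'rV[rat]_n).

Lemma ord_lt p u : preorder_lt (set_val p) 0 u = (u != 0) && set_val p 0 u.
Proof.
rewrite /preorder_lt andbC; have [pu|_] := boolP (set_val p 0 u); rewrite ?andbF //.
rewrite !andbT; congr (~~ _); apply/idP/eqP => [up|->]; last exact: preorder_refl.
by apply: (set_valP p); rewrite up.
Qed.

Lemma ord_ltN p u : u != 0 ->
  preorder_lt (set_val p) 0 (- u) = ~~ preorder_lt (set_val p) 0 u.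
Proof.
move=> u0; rewrite !ord_lt oppr_eq0 u0 /= -preorder_le0N.
apply/idP/idP => [up|]; last first.
  by move=> /negPf pu; have := preorder_total (set_val p) 0 u; rewrite pu.
by apply: contra u0 => pu; apply/eqP; apply: (set_valP p); rewrite up.
Qed.

Lemma ord_separated p q : p <> q ->
  exists2 u, u != 0 & preorder_lt (set_val p) 0 u /\ ~ preorder_lt (set_val q) 0 u.
Proof.
move=> pq; apply: contrapT => nu; apply: pq; apply: val_inj; apply: ZR_ext => u.
have sub v : preorder_lt (set_val p) 0 v -> preorder_lt (set_val q) 0 v.
  move=> pv; apply: contrapT => qv; apply: nu; exists v => //.
  by move: pv; rewrite ord_lt => /andP[].
have [->|u0] := eqVneq u 0; first by rewrite !preorder_refl.
have := sub u; have := sub (- u); rewrite !ord_ltN // !ord_lt u0 /=.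
by case: (set_val p 0 u); case: (set_val q 0 u) => //;
  [move=> _ /(_ isT)|move=> /(_ isT)].
Qed.

Lemma ord_lt_clopen u : u != 0 ->
  clopen [set p : Ord n | preorder_lt (set_val p) 0 u].
Proof.
have ord_lt_open v : open [set p : Ord n | preorder_lt (set_val p) 0 v].
  by exists (@inverse_subbase n v) => //; exact: inverse_subbase_open.
move=> u0; split=> //.
rewrite (_ : mkset _ = ~` [set p : Ord n | preorder_lt (set_val p) 0 (- u)]).
  exact: open_closedC.
apply/funext => p; apply/propext; rewrite /= ord_ltN //.
by split=> [-> //|/negP/negPn].
Qed.

Lemma ord_totally_disconnected : totally_disconnected [set: Ord n].
Proof.
apply: zero_dimension_totally_disconnected => p q /eqP/ord_separated[u u0 [pu qu]].
by exists [set r : Ord n | preorder_lt (set_val r) 0 u]; split=> //;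
  exact: ord_lt_clopen.
Qed.

Section UltrafilterLimit.
Variables (F : set_system (Ord n)) (UF : UltraFilter F).

(** The comparisons that almost all orders, in the sense of [F], agree to. *)
Definition limit_rel : rel 'rV[rat]_n :=
  fun u v => `[< F [set q : Ord n | set_val q u v] >].

(** Totality comes from maximality: of the set of orders with [u <= v] and its
    complement, the ultrafilter contains one. *)
Lemma limit_total : total limit_rel.
Proof.
move=> u v; apply/orP.
have [uv|nuv] := in_ultra_setVsetC [set q : Ord n | set_val q u v] UF.
  by left; apply/asboolP.
right; apply/asboolP; apply: filterS nuv => q /= /negP.
by have := preorder_total (set_val q) u v; case: (set_val q u v).
Qed.

Lemma limit_trans : transitive limit_rel.
Proof.
move=> v u w /asboolP uv /asboolP vw; apply/asboolP.
by apply: filterS2 uv vw => q; exact: preorder_trans.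
Qed.

Lemma limit_translation w u v : limit_rel u v -> limit_rel (w + u) (w + v).
Proof.
move=> /asboolP uv; apply/asboolP; apply: filterS uv => q.
exact: preorder_translation.
Qed.

Definition limit_preorder : ZR n := MkZR limit_total limit_trans limit_translation.

Lemma limit_order : Ord n limit_preorder.
Proof.
move=> u v /andP[/asboolP uv /asboolP vu].
have [q [quv qvu]] := filter_ex (filterI uv vu).
by apply: (set_valP q); rewrite quv.
Qed.

End UltrafilterLimit.

Lemma ord_compact : compact [set: Ord n].
Proof.
rewrite compact_ultra => F UF _.
exists (SigSub (mem_set (@limit_order F UF))); split=> //.
have FF : Filter F by exact: filter_filter.
apply: inverse_cvg => u /andP[/asboolP Fu nFu].
have [uF|uF] := in_ultra_setVsetC [set q : Ord n | set_val q u 0] UF.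
  by move: nFu => /negP[]; apply/asboolP.
by apply: filterS2 Fu uF => q /= qu /negP uq; apply/andP.
Qed.

Lemma exists_orthogonal (l : 'rV[rat]_n) : (2 <= n)%N ->
  exists2 w, w != 0 & dot l w = 0.
Proof.
move=> n2; pose i := Ordinal (ltnW n2); pose j := Ordinal n2.
have [li|li] := eqVneq (l 0 i) 0.
  exists (delta_mx 0 i); last by rewrite dot_deltar.
  by apply/eqP => /rowP/(_ i); rewrite !mxE !eqxx.
exists (l 0 j *: delta_mx 0 i - l 0 i *: delta_mx 0 j).
  apply/eqP => /rowP/(_ j); rewrite !mxE !eqxx /= mulr0 mulr1 add0r => /eqP.
  by rewrite oppr_eq0 (negPf li).
by rewrite dotD dotN !dotZ !dot_deltar !ratr_id mulrC subrr.
Qed.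

(** A basic neighbourhood of [p] is given by finitely many vectors positive for
    [p]. A rational form [l] positive on all of them has a nonzero vector [w] in
    its kernel when the dimension is at least two. Breaking the ties of [l] by
    the opposite of [p] gives an order in the neighbourhood that disagrees with
    [p] on the sign of [w]. *)
Lemma ord_no_isolated : (2 <= n)%N -> isolated [set: Ord n] = set0.
Proof.
move=> n2; apply/seteqP; split=> // p [_ [V /inverse_nbhsP[s ps sV]]].
rewrite setIT => Vp; have [l ls] := positive_form ps.
have [w w0 lw] := exists_orthogonal l n2.
have opposite_order : Ord n (opposite (set_val p)).
  by move=> u v uv; apply: (set_valP p); rewrite andbC.
pose q : Ord n := SigSub (mem_set (lexprod_order (p := halfspace l) opposite_order)).
have qp : q = p.
  have : V q by apply: sV => u us; apply: lexprod_lt; rewrite halfspace_lt ls.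
  by rewrite Vp.
have qw v : dot l v = 0 -> set_val q 0 v = set_val p v 0.
  by move=> lv; rewrite /= /lexprod_rel /= /halfspace_rel dot0 lv lexx.
have pw : set_val p 0 w = set_val p w 0 by rewrite -(qw w lw) qp.
have /eqP[] := w0; apply: (set_valP p).
by have := preorder_total (set_val p) 0 w; rewrite -pw orbb => ->.
Qed.

(** * An ultrametric on the space of orders *)

Section Ultrametric.
Variable R : realType.

Definition code_weight u : R := (pickle u).+1%:R^-1.

(** The sign of [u] is read off from the comparison of [0] with [u]. The element
    [0] keeps the set nonempty when the orders coincide. *)
Definition ord_dist p q : R :=
  sup (0 |` [set code_weight u | u in [set u | set_val p 0 u != set_val q 0 u]]).

Lemma ord_dist_ub p q : ubound (0 |` [set code_weight u |
  u in [set u | set_val p 0 u != set_val q 0 u]]) (1 : R).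
Proof.
by move=> _ [->|[u _ <-]]; rewrite ?ler01 // invf_le1 ?ler1n ?ltr0n.
Qed.

Lemma code_weight_le_dist p q u :
  set_val p 0 u != set_val q 0 u -> code_weight u <= ord_dist p q.
Proof.
move=> pqu; apply: ub_le_sup; first by exists 1; exact: ord_dist_ub.
by right; exists u.
Qed.

Lemma ord_dist_ge0 p q : 0 <= ord_dist p q.
Proof. by apply: ub_le_sup; [exists 1; exact: ord_dist_ub|left]. Qed.

Lemma ord_dist_le p q x : 0 <= x ->
  (forall u, set_val p 0 u != set_val q 0 u -> code_weight u <= x) ->
  ord_dist p q <= x.
Proof.
move=> x0 ux; apply: ge_sup; first by exists 0; left.
by move=> _ [->//|[u /ux uw <-]].
Qed.

Lemma ord_dist_ultrametric : is_ultrametric ord_dist.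
Proof.
have sym p q : ord_dist p q = ord_dist q p.
  by apply/eqP; rewrite eq_le; apply/andP; split; apply: ord_dist_le;
    rewrite ?ord_dist_ge0 // => u; rewrite eq_sym; exact: code_weight_le_dist.
have ultra p q r : ord_dist p r <= Num.max (ord_dist p q) (ord_dist q r).
  apply: ord_dist_le => [|u pru]; first by rewrite le_max ord_dist_ge0.
  rewrite le_max; have [pq|/code_weight_le_dist->//] :=
    eqVneq (set_val p 0 u) (set_val q 0 u).
  by rewrite (@code_weight_le_dist q r) ?orbT // -pq.
split=> //; split=> // [|p q|p q r]; first exact: ord_dist_ge0.
  split=> [pq0|->]; last first.
    by apply/eqP; rewrite eq_le ord_dist_ge0 andbT ord_dist_le // => u /eqP[].
  apply: val_inj; apply: ZR_ext => u; apply/eqP; apply: contrapT => /negP.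
  by move=> /code_weight_le_dist; rewrite pq0 leNgt invr_gt0 ltr0n.
by apply: le_trans (ultra p q r) _; rewrite ge_max lerDl lerDr !ord_dist_ge0.
Qed.

(** A finite set of vectors has bounded codes, so orders that are close enough
    agree on it; and the finitely many vectors with small codes have signs that
    are fixed by open conditions. *)
Lemma ord_dist_defines_topology : defines_topology ord_dist.
Proof.
move=> p; apply/seteqP; split=> V.
  move=> /inverse_nbhsP[s ps sV]; pose k := \max_(u <- s) pickle u.
  exists (k.+1%:R^-1) => [|q /= pqk]; first by rewrite /= invr_gt0 ltr0n.
  apply: sV => u us; have := ps u us; rewrite !ord_lt => /andP[-> pu] /=.
  suff <- : set_val p 0 u = set_val q 0 u by [].
  apply/eqP; apply: contrapT => /negP /code_weight_le_dist /le_lt_trans.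
  move=> /(_ _ pqk); rewrite ltf_pV2 ?posrE ?ltr0n // ltr_nat ltnS ltnNge.
  by rewrite /k (leq_bigmax_seq _ us).
move=> [e /= e0 eV]; apply/inverse_nbhsP.
pose k := Num.bound e^-1; pose s := pmap unpickle (iota 0 k) : seq 'rV[rat]_n.
(* The Inverse topology only has positivity conditions; the sign of a negative
   vector of [s] is fixed by the positivity of its opposite. *)
exists [seq u <- s ++ map -%R s | preorder_lt (set_val p) 0 u].
  by move=> u; rewrite mem_filter => /andP[].
move=> q sq; apply: eV => /=; apply: (@le_lt_trans _ _ k.+1%:R^-1); last first.
  rewrite invf_plt ?posrE ?ltr0n //; apply: (@lt_trans _ _ k%:R).
    by apply: archi_boundP; rewrite invr_ge0 ltW.
  by rewrite ltr_nat.
apply: ord_dist_le => [|u pqu]; first by rewrite invr_ge0.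
rewrite lef_pV2 ?posrE ?ltr0n // ler_nat ltnS leqNgt; apply: contraNN pqu => uk.
have us : u \in s.
  by rewrite mem_pmap; apply/mapP; exists (pickle u); rewrite ?mem_iota ?pickleK.
have [->|u0] := eqVneq u 0; first by rewrite !preorder_refl.
have [pu|pu] := boolP (preorder_lt (set_val p) 0 u).
  have /preorder_ltW-> : preorder_lt (set_val q) 0 u.
    by apply: sq; rewrite mem_filter pu mem_cat us.
  by rewrite preorder_ltW.
have qu : ~~ preorder_lt (set_val q) 0 u.
  rewrite -ord_ltN //; apply: sq; rewrite mem_filter ord_ltN // pu mem_cat.
  by rewrite map_f ?orbT.
by move: pu qu; rewrite !ord_lt u0 /= => /negPf-> /negPf->.
Qed.

Lemma ord_ultrametric_cantor : (2 <= n)%N -> ultrametric_cantor_set R (Ord n).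
Proof.
move=> n2; have [um top] := (ord_dist_ultrametric, ord_dist_defines_topology).
split; last by exists ord_dist.
split.
- by have [p pO] := exists_order n; exists (SigSub (mem_set pO)).
- exact: ord_compact.
- by exists ord_dist; split=> //; case: um.
- exact: ord_totally_disconnected.
- exact: ord_no_isolated.
Qed.

End Ultrametric.
End Orders.

(** * The homeomorphism and the projection *)

Lemma exists_direction_map (R : realType) n (A : set (ZR n)) :
  (forall p, A p -> p <> trivial_preorder n) ->
  exists f : A -> sphere R n,
    forall p, coarser (halfspace (set_val (f p))) (set_val p).
Proof.
move=> A0; have /choice[f fP] (p : A) :
    exists l : sphere R n, coarser (halfspace (set_val l)) (set_val p).
  have [l l1 lp] := exists_direction R (A0 _ (set_valP p)).
  by exists (SigSub (mem_set l1)).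
by exists f.
Qed.

Theorem proposition3p19 (R : realType) (n : nat) (hn : (1 <= n)%N) :
  homeomorphic (ZR1 n) (sphere R n) /\
  ((2 <= n)%N ->
    exists pi : Ord n -> ZR1 n,
      [/\ forall p : Ord n,
            unique (fun q : ZR1 n => coarser (set_val q) (set_val p)) (pi p),
          continuous pi,
          set_surj [set: Ord n] [set: ZR1 n] pi &
          ultrametric_cantor_set R (Ord n)]).
Proof.
have [f fP] : exists f : ZR1 n -> sphere R n,
    forall p, coarser (halfspace (set_val (f p))) (set_val p).
  by apply: exists_direction_map => p /rank_oneP[].
have fK : cancel f (@halfspace_ZR1 R n).
  move=> p; apply: val_inj => /=; have /rank_oneP[_ /(_ _ (fP p))[]//] := set_valP p.
  by move=> /(halfspace_nontrivial (sphere_neq0 (set_valP (f p)))).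
have gK : cancel (@halfspace_ZR1 R n) f.
  move=> l; apply: val_inj.
  by apply: direction_unique (set_valP _) (set_valP _) (fP _) _ => u v.
split.
  exists f, (@halfspace_ZR1 R n); split=> //; first exact: direction_continuous.
  exact: halfspace_continuous.
move=> n2; have [h hP] : exists h : Ord n -> sphere R n,
    forall p, coarser (halfspace (set_val (h p))) (set_val p).
  apply: exists_direction_map => p pO pt.
  have : delta_mx 0 (Ordinal hn) = 0 :> 'rV[rat]_n by apply: pO; rewrite pt.
  by move=> /rowP/(_ (Ordinal hn)); rewrite !mxE !eqxx.
exists (@halfspace_ZR1 R n \o h); split.
- move=> p; split=> [|q qp]; first exact: hP.
  rewrite -[q]fK /=; congr halfspace_ZR1; apply: val_inj.
  apply: direction_unique (set_valP _) (set_valP _) (hP p) _ => u v /qp.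
  exact: fP.
- move=> p; apply: continuous_comp; first exact: direction_continuous.
  exact: halfspace_continuous.
- move=> q _; have [r rO] := exists_order n.
  pose p : Ord n := SigSub (mem_set (lexprod_order (p := set_val q) rO)).
  exists p => //=; rewrite -[RHS]fK; congr halfspace_ZR1; apply: val_inj.
  apply: direction_unique (set_valP _) (set_valP _) (hP p) _ => u v puv.
  by apply: fP; exact: lexprod_coarser puv.
- exact: ord_ultrametric_cantor.
Qed.
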